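(* Let $m\ge1$. The set $\mathcal{D}=\{E\in\chi(\mathbb{R}^m):\dim_{\mathcal{H}}E\ne\dim_{\mathcal{A}}E\}$ is dense in $\chi(\mathbb{R}^m)$.
   Context: $\chi(\mathbb{R}^m)$ is the collection of all nonempty compact subsets of $\mathbb{R}^m$, equipped with the Hausdorff metric $\mathfrak{H}$ induced by the Euclidean norm. $\dim_{\mathcal{H}}$ denotes Hausdorff dimension. The Assouad dimension of a nonempty set $E\subseteq\mathbb{R}^m$ is $$\dim_{\mathcal{A}}E=\inf\Big\{\beta\ge0:\ \exists\, C>0\text{ such that for all }0<r<R\text{ and }x\in E,\ N_r(B(x,R)\cap E)\le C\Big(\frac{R}{r}\Big)^\beta\Big\},$$ where $B(x,R)=\{y\in\mathbb{R}^m:\|y-x\|_2\le R\}$ and $N_r(F)$ is the smallest number of open sets of diameter at most $r$ needed to cover $F$. *)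

(* Defs.v *)
From HB Require Import structures.
From mathcomp Require Import all_boot all_order all_algebra.
From mathcomp Require Import all_classical all_reals all_analysis.
From mathcomp Require Import ring lra.

Set Implicit Arguments.
Unset Strict Implicit.
Unset Printing Implicit Defensive.

Import Order.TTheory GRing.Theory Num.Theory.
Import numFieldNormedType.Exports.

Local Open Scope classical_set_scope.
Local Open Scope ring_scope.

(* R^m is the type 'rV[R]_m.  The library norm on matrices is the max norm; it
   induces the usual topology (hence the library's [open] and [compact] are the
   Euclidean ones), but all distances below are Euclidean. *)
Definition enorm (R : realType) (m : nat) (x : 'rV[R]_m) : R :=
  Num.sqrt (\sum_i x ord0 i ^+ 2).

Section EuclideanNorm.
Context {R : realType} {m : nat}.
Implicit Types x y z : 'rV[R]_m.

Lemma enorm_ge0 x : 0 <= enorm x.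
Proof. exact: sqrtr_ge0. Qed.

Lemma sumsq_ge0 x : 0 <= \sum_i x ord0 i ^+ 2.
Proof. by apply: sumr_ge0 => i _; exact: sqr_ge0. Qed.

Lemma enorm0 : enorm (0 : 'rV[R]_m) = 0.
Proof. by rewrite /enorm big1 ?sqrtr0// => i _; rewrite mxE expr0n. Qed.

Lemma enormN x : enorm (- x) = enorm x.
Proof. by rewrite /enorm; under eq_bigr do rewrite mxE sqrrN. Qed.

Lemma enormB x y : enorm (x - y) = enorm (y - x).
Proof. by rewrite -enormN opprB. Qed.

Lemma le_coord_enorm x i : `|x ord0 i| <= enorm x.
Proof.
rewrite -sqrtr_sqr ler_wsqrtr// (bigD1 i)//= lerDl.
by apply: sumr_ge0 => j _; exact: sqr_ge0.
Qed.

Lemma cauchy_schwarz x y : \sum_i x ord0 i * y ord0 i <= enorm x * enorm y.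
Proof.
rewrite /enorm -sqrtrM ?sumsq_ge0//.
apply: (le_trans (ler_norm _)); rewrite -sqrtr_sqr ler_wsqrtr//.
set a := fun i => x ord0 i; set b := fun i => y ord0 i.
have : 0 <= \sum_i \sum_j (a i * b j - a j * b i) ^+ 2.
  by apply: sumr_ge0 => i _; apply: sumr_ge0 => j _; exact: sqr_ge0.
have -> : \sum_i \sum_j (a i * b j - a j * b i) ^+ 2 =
  \sum_i \sum_j (a i ^+ 2 * b j ^+ 2) + \sum_i \sum_j (a j ^+ 2 * b i ^+ 2)
  - 2 * \sum_i \sum_j (a i * b i) * (a j * b j).
  rewrite mulr_sumr -big_split -sumrB /=; apply: eq_bigr => i _.
  rewrite mulr_sumr -big_split -sumrB /=; apply: eq_bigr => j _.
  by ring.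
rewrite (exchange_big _ _ _ _ _ (fun i j => a j ^+ 2 * b i ^+ 2))/=.
rewrite -!big_distrlr /=.
by rewrite -/a -/b expr2; lra.
Qed.

Lemma enormD x y : enorm (x + y) <= enorm x + enorm y.
Proof.
rewrite -(@ler_pXn2r _ 2)// ?nnegrE ?addr_ge0 ?enorm_ge0//.
rewrite [leLHS]sqr_sqrtr ?sumsq_ge0// sqrrD.
rewrite {1 3}/enorm !sqr_sqrtr ?sumsq_ge0//.
have -> : \sum_i (x + y) ord0 i ^+ 2 = \sum_i x ord0 i ^+ 2 +
   (\sum_i x ord0 i * y ord0 i) *+ 2 + \sum_i y ord0 i ^+ 2.
  rewrite -sumrMnl -!big_split /=; apply: eq_bigr => i _.
  by rewrite mxE; ring.
by rewrite lerD2r lerD2l lerMn2r /= cauchy_schwarz.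
Qed.

Lemma enorm_triangle y x z : enorm (x - z) <= enorm (x - y) + enorm (y - z).
Proof.
by apply: le_trans (enormD _ _); rewrite addrA subrK.
Qed.

Lemma enorm_continuous : continuous (@enorm R m).
Proof.
have sq i : continuous (fun x : 'rV[R]_m => x ord0 i ^+ 2).
  move=> x; apply: (@cvgM R _ (nbhs x) _ (fun x : 'rV[R]_m => x ord0 i)
    (fun x : 'rV[R]_m => x ord0 i)); exact: coord_continuous.
have sumsq : continuous (fun x : 'rV[R]_m => \sum_i x ord0 i ^+ 2).
  move=> x; apply: (@cvg_big R _ +%R 0 xpredT (@add_continuous R) _ (nbhs x) _
    (fun i (x : 'rV[R]_m) => x ord0 i ^+ 2) (fun i => x ord0 i ^+ 2)
    (nbhs_filter x)) => i _.
  exact: sq.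
move=> x; apply: (continuous_comp (sumsq x)); exact: sqrt_continuous.
Qed.

End EuclideanNorm.

Definition dist_to (R : realType) (m : nat) (x : 'rV[R]_m) (B : set 'rV[R]_m) : R :=
  inf [set enorm (x - b) | b in B].

Record hyperspace (R : realType) (m : nat) := Hyperspace {
  hset : set 'rV[R]_m ;
  hset_neq0 : hset !=set0 ;
  hset_compact : compact hset }.

Definition hausdorff_dist (R : realType) (m : nat) (A B : hyperspace R m) : R :=
  Num.max (sup [set dist_to a (hset B) | a in hset A])
          (sup [set dist_to b (hset A) | b in hset B]).

HB.instance Definition _ (R : realType) (m : nat) :=
  gen_eqMixin (hyperspace R m).
HB.instance Definition _ (R : realType) (m : nat) :=
  gen_choiceMixin (hyperspace R m).

Section HausdorffMetric.
Context {R : realType} {m : nat}.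
Implicit Types (A B C : hyperspace R m) (x : 'rV[R]_m).

Lemma hyperspace_inj A B : hset A = hset B -> A = B.
Proof.
case: A B => [A A0 Ac] [B B0 Bc] /= AB; rewrite AB in A0 Ac *.
by congr Hyperspace; exact: Prop_irrelevance.
Qed.

Lemma has_inf_dist x B : has_inf [set enorm (x - b) | b in hset B].
Proof.
split; first by have [b Bb] := hset_neq0 B; exists (enorm (x - b)), b.
by exists 0 => _ [b _ <-]; exact: enorm_ge0.
Qed.

Lemma dist_to_le x B b : hset B b -> dist_to x (hset B) <= enorm (x - b).
Proof. by move=> Bb; apply: ge_inf; [case: (has_inf_dist x B)|exists b]. Qed.

Lemma dist_to_ge0 x B : 0 <= dist_to x (hset B).
Proof.
by apply: lb_le_inf; [case: (has_inf_dist x B)|move=> _ [b _ <-]; exact: enorm_ge0].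
Qed.

Lemma has_sup_dist A B : has_sup [set dist_to a (hset B) | a in hset A].
Proof.
split; first by have [a Aa] := hset_neq0 A; exists (dist_to a (hset B)), a.
have [b Bb] := hset_neq0 B.
have /compact_bounded [M [_ hM]] : compact [set enorm a | a in hset A].
  apply: continuous_compact; last exact: hset_compact.
  exact/continuous_subspaceT/enorm_continuous.
exists (M + 1 + enorm b) => _ [a Aa <-].
apply: (le_trans (dist_to_le a Bb)); apply: (le_trans (enormD _ _)).
rewrite enormN lerD2r.
apply: le_trans (ler_norm _) _; apply: (hM (M + 1)); first by rewrite ltrDl.
by exists a.
Qed.

Lemma dist_to_le_sup A B a : hset A a ->
  dist_to a (hset B) <= sup [set dist_to a (hset B) | a in hset A].
Proof. by move=> Aa; apply: sup_upper_bound; [exact: has_sup_dist|exists a]. Qed.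

Lemma dist_to_triangle x B C :
  dist_to x (hset C) <= dist_to x (hset B) + sup [set dist_to b (hset C) | b in hset B].
Proof.
rewrite -lerBlDr; apply: lb_le_inf; first by case: (has_inf_dist x B).
move=> _ [b Bb <-]; rewrite lerBlDr.
apply: (@le_trans _ _ (enorm (x - b) + dist_to b (hset C))); last first.
  by rewrite lerD2l dist_to_le_sup.
rewrite -lerBlDl; apply: lb_le_inf; first by case: (has_inf_dist b C).
move=> _ [c Cc <-]; rewrite lerBlDl.
exact: le_trans (dist_to_le x Cc) (enorm_triangle b x c).
Qed.

Lemma dist_to_eq0 x B : dist_to x (hset B) = 0 -> hset B x.
Proof.
move=> xB0.
have cB : continuous (fun b : 'rV[R]_m => x - b).
  move=> b; apply: (@cvgB R _ _ (nbhs b) (nbhs_filter b) (fun=> x) id);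
    [exact: cvg_cst|exact: cvg_id].
have cf : continuous (fun b : 'rV[R]_m => enorm (x - b)).
  by move=> b; apply: (continuous_comp (cB b)); exact: enorm_continuous.
have [b /set_mem Bb hb] := EVT_min_rV (hset_neq0 B) (@hset_compact _ _ B)
  (continuous_subspaceT cf).
have : enorm (x - b) <= 0.
  rewrite -xB0; apply: lb_le_inf; first by case: (has_inf_dist x B).
  by move=> _ [c Bc <-]; apply: hb; exact/mem_set.
move=> xb0; suff -> : x = b by [].
apply/rowP => i; apply/eqP; rewrite -subr_eq0 -normr_le0.
by have := le_trans (le_coord_enorm (x - b) i) xb0; rewrite !mxE.
Qed.

Lemma hausdorff_distxx A : hausdorff_dist A A = 0.
Proof.
rewrite /hausdorff_dist maxxx.
suff -> : [set dist_to a (hset A) | a in hset A] = [set 0] by rewrite sup1.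
have h a : hset A a -> dist_to a (hset A) = 0.
  move=> Aa; apply/eqP; rewrite eq_le dist_to_ge0 andbT.
  by rewrite -(@enorm0 R m) -(subrr a) dist_to_le.
apply/seteqP; split => [_ [a Aa <-]|_ ->]; first exact: h.
by have [a Aa] := hset_neq0 A; exists a => //; exact: h.
Qed.

Lemma hausdorff_dist_sym A B : hausdorff_dist A B = hausdorff_dist B A.
Proof. exact: maxC. Qed.

Lemma hausdorff_dist_positivity A B : hausdorff_dist A B = 0 -> A = B.
Proof.
move=> AB0; have: hausdorff_dist A B <= 0 by rewrite AB0.
rewrite ge_max => /andP[AB BA].
apply: hyperspace_inj; apply/seteqP; split => x Xx; apply: dist_to_eq0;
  apply/eqP; rewrite eq_le dist_to_ge0 andbT.
- exact: le_trans (dist_to_le_sup B Xx) AB.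
- exact: le_trans (dist_to_le_sup A Xx) BA.
Qed.

Lemma sup_dist_triangle A B C :
  sup [set dist_to a (hset C) | a in hset A] <=
  sup [set dist_to a (hset B) | a in hset A] +
  sup [set dist_to b (hset C) | b in hset B].
Proof.
apply: ge_sup; first by case: (has_sup_dist A C).
move=> _ [a Aa <-]; apply: (le_trans (dist_to_triangle a B C)).
by rewrite lerD2r dist_to_le_sup.
Qed.

Lemma hausdorff_dist_triangle B A C :
  hausdorff_dist A C <= hausdorff_dist A B + hausdorff_dist B C.
Proof.
rewrite {1}/hausdorff_dist ge_max; apply/andP; split.
  apply: (le_trans (sup_dist_triangle A B C)).
  by apply: lerD; rewrite le_max lexx.
apply: (le_trans (sup_dist_triangle C B A)); rewrite addrC.
by apply: lerD; rewrite le_max lexx orbT.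
Qed.

HB.instance Definition _ := isMetric.Build R (hyperspace R m)
  hausdorff_distxx hausdorff_dist_positivity hausdorff_dist_sym
  hausdorff_dist_triangle.

End HausdorffMetric.

(* Euclidean diameter; the diameter of the empty set is 0. *)
Definition diam (R : realType) (m : nat) (A : set 'rV[R]_m) : \bar R :=
  maxe 0%E (ereal_sup [set (enorm (x - y))%:E | x in A & y in A]).

(* |A|^s, with the usual conventions that |A|^0 = 1 for nonempty A (of any
   diameter, including 0) and that the empty set contributes 0 for every s. *)
Definition diam_pow (R : realType) (m : nat) (s : R) (A : set 'rV[R]_m) : \bar R :=
  if A == set0 then 0%E else poweR (diam A) s.

Definition hausdorff_premeasure (R : realType) (m : nat) (s delta : R)
    (A : set 'rV[R]_m) : \bar R :=
  ereal_inf [set (\sum_(0 <= i <oo) diam_pow s (U i))%E |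
    U in [set U : nat -> set 'rV[R]_m |
      A `<=` \bigcup_i U i /\ forall i, (diam (U i) <= delta%:E)%E]].

Definition hausdorff_measure (R : realType) (m : nat) (s : R)
    (A : set 'rV[R]_m) : \bar R :=
  ereal_sup [set hausdorff_premeasure s delta A | delta in [set d : R | 0 < d]].

Definition hausdorff_dim (R : realType) (m : nat) (A : set 'rV[R]_m) : \bar R :=
  ereal_inf [set s%:E | s in [set s : R | 0 <= s /\ hausdorff_measure s A = 0%E]].

Definition eball (R : realType) (m : nat) (x : 'rV[R]_m) (r : R) : set 'rV[R]_m :=
  [set y | enorm (y - x) <= r].

(* +oo when no finite cover exists. *)
Definition covering_number (R : realType) (m : nat) (r : R)
    (F : set 'rV[R]_m) : \bar R :=
  ereal_inf [set n%:R%:E | n in [set n : nat |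
    exists U : 'I_n -> set 'rV[R]_m,
      (forall i, open (U i) /\ (diam (U i) <= r%:E)%E) /\
      F `<=` \bigcup_i U i]].

Definition assouad_dim (R : realType) (m : nat) (E : set 'rV[R]_m) : \bar R :=
  ereal_inf [set b%:E | b in [set b : R | 0 <= b /\
    exists2 C : R, 0 < C &
      forall (r rho : R) (x : 'rV[R]_m), 0 < r -> r < rho -> E x ->
        (covering_number r (eball x rho `&` E) <= (C * (rho / r) `^ b)%:E)%E]].

(* Main.v *)
(* Replace a compact set A by a finite d-net of A together with a small copy
   {p} u {p + d/(n+1) e : n} of {0} u {1/n} placed at a point p of A.  The new
   set is countable and compact, hence of Hausdorff dimension 0, and within
   Hausdorff distance d of A.  Its first k sequence points are separated by at
   least d/k^2 inside a ball of radius d, so a covering exponent b satisfies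
   k <= C (2 k^2)^b for all k, and the Assouad dimension is positive. *)
Require Import Defs.
From mathcomp Require Import all_boot all_order all_algebra.
From mathcomp Require Import all_classical all_reals all_analysis.
From mathcomp Require Import finmap ring lra zify.

Import Order.TTheory GRing.Theory Num.Theory.
Import numFieldNormedType.Exports.

Local Open Scope classical_set_scope.
Local Open Scope ring_scope.

(** A proper filter on the set either clusters at [p], or has a member [A] missing a neighbourhood
    [B] of [p]. All terms from some [N] on lie in [B], so [A] meets the set in finitely many terms,
    and the filter clusters at one of them. *)
Lemma compact_cvg_range (T : topologicalType) (u : nat -> T) (p : T) :
  u @ \oo --> p -> compact (p |` range u).
Proof.
move=> up F PF FK.
have [cp|] := pselect (cluster F p); first by exists p; split => //; left.
move=> /existsNP[A /existsNP[B /not_implyP[FA /not_implyP[pB AB0]]]].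
have [N _ uN] := up _ pB.
have cA : compact (A `&` (p |` range u)).
  apply/finite_compact/(sub_finite_set _ (finite_image u (finite_II N))).
  move=> q [Aq [qp|[n _ unq]]].
    by exfalso; apply: AB0; exists q; split => //; rewrite qp; exact: nbhs_singleton.
  exists n => //=; rewrite ltnNge; apply/negP => Nn.
  by apply: AB0; exists q; split => //; rewrite -unq; exact: uN.
have [q [[Aq Kq] cq]] := cA F PF (filterI FA FK).
by exists q.
Qed.

Section Dimensions.
Context {R : realType} {m : nat}.
Implicit Types (A E : set 'rV[R]_m) (x p e : 'rV[R]_m).

Lemma diam_subsingleton A :
  (forall x y, A x -> A y -> x = y) -> diam A = 0%E.
Proof.
move=> A1; rewrite /diam; apply/max_idPl/ge_ereal_sup.
by move=> _ [x Ax [y Ay <-]]; rewrite (A1 x y)// subrr enorm0.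
Qed.

Lemma hausdorff_measure_countable (s : R) A :
  0 < s -> countable A -> hausdorff_measure s A = 0%E.
Proof.
move=> s0 /countable_injP[g gI].
have diam_ge0 (B : set 'rV[R]_m) : (0 <= diam_pow s B)%E.
  by rewrite /diam_pow; case: ifP => // _; exact: poweR_ge0.
(* The fibres of the injection [g] have at most one point each. They cover [A] at every scale at
   cost [0], since [0] to the power [s] vanishes for [s > 0]. *)
pose U i := [set x | A x /\ g x = i].
have dU i : diam (U i) = 0%E.
  apply: diam_subsingleton => x y [Ax gx] [Ay gy].
  by apply: gI; [exact: mem_set|exact: mem_set|rewrite gx gy].
have pre0 d : 0 < d -> hausdorff_premeasure s d A = 0%E.
  move=> d0; apply/eqP; rewrite eq_le; apply/andP; split.
    apply: ereal_inf_lbound; exists U.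
      split; first by move=> x Ax; exists (g x).
      by move=> i; rewrite dU lee_fin ltW.
    rewrite eseries0// => i _ _; rewrite /diam_pow; case: ifP => // _.
    by rewrite dU poweR0r// gt_eqF.
  by apply: le_ereal_inf_tmp => _ [V _ <-]; exact: nneseries_ge0.
rewrite /hausdorff_measure (_ : [set _ | _ in _] = [set 0%E]) ?ereal_sup1//.
apply/seteqP; split => [_ [d d0 <-]|_ ->]; first exact: pre0.
by exists 1; [exact: ltr01|exact/pre0/ltr01].
Qed.

Lemma hausdorff_dim_countable_le (s : R) A :
  0 < s -> countable A -> (hausdorff_dim A <= s%:E)%E.
Proof.
move=> s0 cA; apply: ereal_inf_lbound; exists s => //.
by split; [exact: ltW|exact: hausdorff_measure_countable].
Qed.

(** Pigeonhole: a set of diameter at most [r] holds at most one of the points, so assigning to each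
    point a covering set that contains it is injective. *)
Lemma covering_number_ge (k : nat) (r : R) A (x : 'I_k -> 'rV[R]_m) :
  (forall i, A (x i)) ->
  (forall i j, i != j -> r < enorm (x i - x j)) ->
  (k%:R%:E <= covering_number r A)%E.
Proof.
move=> Ax xr; apply: le_ereal_inf_tmp => _ [n [U [Ur AU]] <-].
rewrite lee_fin ler_nat.
have /choice[f fU] i : exists j : 'I_n, U j (x i).
  by have [j _ Uj] := AU _ (Ax i); exists j.
suff /leq_card : injective f by rewrite !card_ord.
move=> i j fij; apply/eqP; apply: contraT => /xr; rewrite ltNge => /negP[].
rewrite -lee_fin; apply: le_trans (Ur (f i)).2.
rewrite /diam le_max; apply/orP; right; apply: ereal_sup_ubound.
by exists (x i) => //; exists (x j) => //; rewrite fij.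
Qed.

Lemma harmonic_separated (k i j : nat) :
  (i < k)%N -> (j < k)%N -> i != j ->
  (k%:R ^+ 2)^-1 <= `|harmonic i - harmonic j| :> R.
Proof.
move=> + + ij.
wlog {ij} ij : i j / (i < j)%N.
  move=> H ik jk; have [/H|/H|/eqP] := ltngtP i j; first exact.
    by rewrite distrC; exact.
  by rewrite (negbTE ij).
move=> ik jk; apply: le_trans (ler_norm _); rewrite /harmonic/=.
have k0 : 0 < k%:R :> R by rewrite ltr0n; lia.
have i0 : 0 < i.+1%:R :> R by rewrite ltr0n.
have j0 : 0 < j.+1%:R :> R by rewrite ltr0n.
have ij' : 1 <= j.+1%:R - i.+1%:R :> R.
  by rewrite lerBrDr nat1r ler_nat.
(* In this form the numerator is at least 1 and both factors of the denominator are at most [k]. *)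
rewrite (_ : i.+1%:R^-1 - j.+1%:R^-1 =
    (j.+1%:R - i.+1%:R) * (i.+1%:R * j.+1%:R)^-1); last first.
  by field; rewrite !gt_eqF.
apply: (@le_trans _ _ ((i.+1%:R * j.+1%:R)^-1)); last first.
  by rewrite ler_peMl// invr_ge0 mulr_ge0// ltW.
rewrite lef_pV2 ?posrE ?mulr_gt0 ?exprn_gt0// expr2.
by apply: ler_pM; rewrite ?ler_nat// ltW.
Qed.

Lemma enormZ (a : R) x : enorm (a *: x) = `|a| * enorm x.
Proof.
rewrite /enorm -sqrtr_sqr -sqrtrM ?sqr_ge0//; congr Num.sqrt.
by rewrite mulr_sumr; apply: eq_bigr => i _; rewrite mxE exprMn.
Qed.

Lemma norm_harmonicM_le (t : R) n : 0 < t -> `|t * harmonic n| <= t.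
Proof.
move=> t0; rewrite ger0_norm; last by rewrite mulr_ge0 ?harmonic_ge0 ?ltW.
by rewrite ger_pMr// invf_le1 ?ltr0n// ler1n.
Qed.

(** Counting the first [k] points in the ball of radius [t] excludes every exponent below 1/2. The
    weaker value 1/4 is enough, and a fourth power removes it. *)
Lemma assouad_dim_harmonic_ge E p e (t : R) : 0 < t -> enorm e = 1 -> E p ->
  (forall n, E (p + (t * harmonic n) *: e)) -> ((4^-1 : R)%:E <= assouad_dim E)%E.
Proof.
move=> t0 e1 Ep Eu; apply: le_ereal_inf_tmp => _ [b [b0 [C C0 CE]] <-].
rewrite lee_fin leNgt; apply/negP => b4.
(* With [b] raised to 1/4 the covering bound would give [k^4 <= 2 C^4 k^2], whereas
   [2 C^4 < k <= k^2]. *)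
pose k := (Num.trunc (2 * C ^+ 4)).+1.
have kC : 2 * C ^+ 4 < k%:R by exact: truncnS_gt.
have k1 : 1 <= k%:R :> R by rewrite ler1n.
have kk1 : 1 <= k%:R ^+ 2 :> R by rewrite exprn_ege1.
have k20 : 0 < 2 * k%:R ^+ 2 :> R by lra.
(* The factor 2 puts [r] strictly below the separation [t / k^2], and below [t] even when
   [k = 1]. *)
pose r := t / (2 * k%:R ^+ 2).
have r0 : 0 < r by rewrite divr_gt0.
have rt : r < t by rewrite ltr_pdivrMr// ltr_pMr//; lra.
have cov : (k%:R%:E <= covering_number r (eball p t `&` E))%E.
  apply: (@covering_number_ge k r _ (fun i => p + (t * harmonic i) *: e)).
    move=> i; split => //; rewrite /eball/= addrC addKr enormZ e1 mulr1.
    by rewrite norm_harmonicM_le.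
  move=> i j ij; rewrite opprD addrACA subrr add0r -scalerBl enormZ e1 mulr1.
  rewrite -mulrBr normrM gtr0_norm// ltr_pM2l//.
  apply: lt_le_trans (@harmonic_separated k i j _ _ _) => //.
  by rewrite ltf_pV2 ?posrE//; lra.
have := le_trans cov (CE r t p r0 rt Ep).
rewrite lee_fin leNgt => /negP; apply.
have -> : t / r = 2 * k%:R ^+ 2 by rewrite /r; field; rewrite !gt_eqF//; lra.
set X := 2 * k%:R ^+ 2 in k20 *.
have X1 : 1 <= X by rewrite /X; lra.
apply: (@le_lt_trans _ _ (C * X `^ 4^-1)).
  by rewrite ler_pM2l// ler_powR// ltW.
have k0 : 0 < k%:R :> R by lra.
rewrite -(@ltr_pXn2r _ 4)// ?nnegrE ?mulr_ge0 ?powR_ge0 1?ltW//.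
rewrite exprMn -(powR_mulrn 4 (powR_ge0 _ _)) -powRrM mulVf// powRr1 1?ltW//.
rewrite /X (_ : k%:R ^+ 4 = k%:R ^+ 2 * k%:R ^+ 2); last by rewrite -exprD.
rewrite mulrA ltr_pM2r; last by lra.
by rewrite mulrC; apply: (lt_le_trans kC); rewrite expr2 ler_peMr// ltW.
Qed.

Lemma enorm_delta (i : 'I_m) : enorm (delta_mx ord0 i : 'rV[R]_m) = 1.
Proof.
rewrite /enorm (bigD1 i)//= big1 => [|j ji]; last first.
  by rewrite mxE eqxx (negbTE ji) expr0n.
by rewrite mxE !eqxx expr1n addr0 sqrtr1.
Qed.

Lemma finite_net A (d : R) : 0 < d -> compact A ->
  exists2 F : set 'rV[R]_m, finite_set F /\ F `<=` A &
    forall a, A a -> exists2 b, F b & enorm (a - b) < d.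
Proof.
move=> d0; rewrite compact_cover => /(_ _ A (fun b => [set a | enorm (a - b) < d])).
case=> [b _|a Aa|D DA AD].
- have cB : continuous (fun a : 'rV[R]_m => a - b).
    by move=> a; apply: (@cvgB R _ _ (nbhs a) _ id (fun=> b));
      [exact: cvg_id|exact: cvg_cst].
  (* The topology comes from the max norm, so a Euclidean ball is shown open as a preimage under the
     continuous [enorm]. *)
  change (open ((fun a => enorm (a - b)) @^-1` [set z : R | z < d])).
  apply: open_comp.
    move=> a _; apply: (continuous_comp (cB a)); exact: enorm_continuous.
  exact: open_lt.
- by exists a => //=; rewrite subrr enorm0.
- exists [set` D]; first split => //.
    by move=> a /DA /set_mem.
  by move=> a /AD[b bD ab]; exists b.
Qed.

Lemma hausdorff_dist_le (A B : hyperspace R m) (d : R) :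
  (forall a, hset A a -> exists2 b, hset B b & enorm (a - b) <= d) ->
  (forall b, hset B b -> exists2 a, hset A a & enorm (b - a) <= d) ->
  hausdorff_dist A B <= d.
Proof.
move=> AB BA; rewrite /hausdorff_dist ge_max; apply/andP; split.
- apply: ge_sup; first by case: (has_sup_dist A B).
  by move=> _ [a /AB[b Bb ab] <-]; exact: le_trans (dist_to_le _ Bb) ab.
- apply: ge_sup; first by case: (has_sup_dist B A).
  by move=> _ [b /BA[a Aa ab] <-]; exact: le_trans (dist_to_le _ Aa) ab.
Qed.

End Dimensions.

Theorem theorem3p12 (R : realType) (m : nat) (hm : (1 <= m)%N) :
  dense [set E : hyperspace R m | hausdorff_dim (hset E) <> assouad_dim (hset E)].
Proof.
move=> O [A OA] oO.
have /nbhs_ballP[eps /= eps0 AO] : nbhs A O by exact: open_nbhs_nbhs.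
have d0 : 0 < eps / 2 by rewrite divr_gt0.
(* Halving turns the bound [<= d] on the Hausdorff distance into the strict [< eps] of the ball. *)
set d := eps / 2 in d0.
have [F [finF FA] AF] := finite_net _ _ d0 (@hset_compact _ _ A).
have [p Ap] := hset_neq0 A.
(* Here [1 <= m] supplies a coordinate direction along which to place the sequence. *)
pose e : 'rV[R]_m := delta_mx ord0 (Ordinal hm).
have e1 : enorm e = 1 by exact: enorm_delta.
pose u n := p + (d * harmonic n) *: e.
have up : u @ \oo --> p.
  rewrite -[X in _ --> X]addr0; apply: cvgD; first exact: cvg_cst.
  rewrite -(scale0r e); apply: cvgZl; rewrite -(mulr0 d).
  by apply: cvgMr; exact: cvg_harmonic.
pose K := F `|` (p |` range u).
have Kp : K p by right; left.
have Ku n : K (u n) by right; right; exists n.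
have cK : compact K.
  by apply: compactU; [exact: finite_compact|exact: compact_cvg_range].
pose B := @Hyperspace R m K (ex_intro _ p Kp) cK.
exists B; split.
  apply: AO; rewrite ballEmdist/=.
  have dist_le : hausdorff_dist A B <= d.
    apply: hausdorff_dist_le => [a /AF[b Fb /ltW ab]|b].
      by exists b => //; left.
    case=> [Fb|[->|[n _ <-]]].
    - by exists b; [exact: FA|rewrite subrr enorm0 ltW].
    - by exists p => //; rewrite subrr enorm0 ltW.
    - exists p => //; rewrite /u addrC addKr enormZ e1 mulr1.
      by rewrite norm_harmonicM_le.
  by apply: le_lt_trans dist_le _; rewrite /d ltr_pdivrMr// ltr_pMr// ltr1n.
have countK : countable K.
  rewrite /K -bigcup2E; apply: bigcup_countable => // -[|[|n]] _ //=.
    exact: finite_set_countable.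
  rewrite -bigcup2E; apply: bigcup_countable => // -[|[|n']] _ //=.
  exact: card_image_le.
have lbd := assouad_dim_harmonic_ge _ _ _ _ d0 e1 Kp Ku.
(* Any positive number below 1/4 separates the two dimensions; equality would force 1/4 <= 1/8. *)
have ubd : (hausdorff_dim K <= (8^-1 : R)%:E)%E.
  by apply: hausdorff_dim_countable_le.
move=> /= HA; have := le_trans lbd (_ : (_ <= (8^-1 : R)%:E)%E).
by rewrite -HA => /(_ ubd); rewrite lee_fin; lra.
Qed.
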